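(* Let $V$ be a vertex operator algebra whose Zhu's algebra $A(V)$ is semisimple, and let $M$ be an admissible $V$-module. If $\lambda\in\mathbb{C}\setminus(\mathcal{P}(V)+\mathbb{N})$, then $M^{(\lambda)}=0$.
   Context: $\mathbb{N}$ is the set of nonnegative integers. Let $V=(V,Y,\mathbf 1,\omega)$ be a vertex operator algebra over $\mathbb{C}$, $Y(a,z)=\sum_{n\in\mathbb{Z}}a(n)z^{-n-1}$, graded by eigenvalues of $L(0)=\omega(1)$; $\mathrm{wt}(a)$ denotes the $L(0)$-eigenvalue of a homogeneous $a$. A weak $V$-module is a vector space $M$ with a linear map $Y_M:V\to(\mathrm{End}\,M)[[z,z^{-1}]]$, $Y_M(a,z)=\sum_{n\in\mathbb{Z}}a(n)z^{-n-1}$, such that $Y_M(a,z)u\in M((z))$ for $a\in V$, $u\in M$, $Y_M(\mathbf 1,z)=\mathrm{id}_M$, and the Jacobi identity $z_0^{-1}\delta(\frac{z_1-z_2}{z_0})Y_M(a,z_1)Y_M(b,z_2)-z_0^{-1}\delta(\frac{z_2-z_1}{-z_0})Y_M(b,z_2)Y_M(a,z_1)=z_2^{-1}\delta(\frac{z_1-z_0}{z_2})Y_M(Y(a,z_0)b,z_2)$ holds. Write $Y_M(\omega,z)=\sum_nL(n)z^{-n-2}$. An admissible $V$-module is a weak $V$-module with an $\mathbb{N}$-grading $M=\bigoplus_{n=0}^\infty M_n$ such that $a(n)M_m\subset M_{\mathrm{wt}(a)+m-n-1}$ for homogeneous $a$ ($M_m=0$ for $m<0$). Its degree operator $d$ acts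 on $M_n$ by $n$. An admissible submodule is a subspace stable under all $a(n)$ and under $d$. An admissible module is irreducible if it is nonzero and its only admissible submodules are $0$ and itself. Zhu's algebra: for homogeneous $a\in V$ and $b\in V$ put $a\circ b=\mathrm{Res}_z\frac{(1+z)^{\mathrm{wt}(a)}}{z^2}Y(a,z)b$ and $a*b=\mathrm{Res}_z\frac{(1+z)^{\mathrm{wt}(a)}}{z}Y(a,z)b$ (extended linearly in $a$); $O(V)$ is the span of all $a\circ b$ and $A(V)=V/O(V)$, an associative algebra under $*$. For an irreducible admissible $V$-module $M$ there is $\lambda\in\mathbb{C}$ with $M=\bigoplus_{n=0}^\infty M(\lambda+n)$, where $M(\lambda+n)$ is the $L(0)$-eigenspace of eigenvalue $\lambda+n$ and $M(\lambda)\ne0$; $\lambda$ is called the lowest weight of $M$. $\mathcal{P}(V)$ is the set of lowest weights of all irreducible admissible $V$-modules. For a weak $V$-module $M$ and $\lambda\in\mathbb{C}$, $M^{(\lambda)}=\{u\in M\mid (L(0)-\lambda)^ku=0\text{ for some }k\in\mathbb{N}\}$. *)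

(* Defs.v *)
From HB Require Import structures.
From mathcomp Require Import all_boot all_order all_algebra.
From mathcomp Require Import mathcomp_extra boolp classical_sets functions.
From mathcomp Require Import cardinality fsbigop reals.
From mathcomp Require Export complex.

Set Implicit Arguments.
Unset Strict Implicit.
Unset Printing Implicit Defensive.

Import Order.TTheory GRing.Theory Num.Theory.
Local Open Scope classical_set_scope.
Local Open Scope ring_scope.
Local Open Scope quotient_scope.

Section LinearAlgebra.
Variable K : numFieldType.
Implicit Type E : lmodType K.

Definition subspace E (S : set E) : Prop :=
  S 0 /\ forall (c : K) (x y : E), S x -> S y -> S (c *: x + y).

Definition lin_span E (S : set E) : set E :=
  [set v | exists (n : nat) (c : 'I_n -> K) (x : 'I_n -> E),
     (forall i, S (x i)) /\ v = \sum_(i < n) c i *: x i].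

Definition finite_dim E (S : set E) : Prop :=
  exists (n : nat) (e : 'I_n -> E), S `<=` lin_span (range e).

Definition eig_space E (f : E -> E) (c : K) : set E :=
  [set v | f v = c *: v].

Definition gen_eig_space E (f : E -> E) (c : K) : set E :=
  [set v | exists k : nat, iter k (fun w => f w - c *: w) v = 0].

Definition is_decomposition E (I : choiceType) (G : I -> set E) (u : E)
    (f : I -> E) : Prop :=
  [/\ forall i, G i (f i), finite_set [set i | f i != 0]
    & u = \sum_(i \in [set: I]) f i].

Definition direct_sum E (I : choiceType) (G : I -> set E) : Prop :=
  (forall i, subspace (G i)) /\
  (forall u : E, exists! f : I -> E, is_decomposition G u f).

Definition component E (I : choiceType) (G : I -> set E) (i : I) (u : E) : E :=
  xget 0 [set x | exists2 f, is_decomposition G u f & x = f i].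

(* Generalized binomial coefficient: the coefficient of z^i in (1 + z)^n *)
Definition gbinom (n : int) (i : nat) : K :=
  (\prod_(j < i) (n%:~R - j%:R)) / i`!%:R.

(* The predicates below only see an algebra through its underlying space and *)
(* its product; semisimplicity is that of the left regular module.           *)

Definition left_ideal E (mul : E -> E -> E) (I : set E) : Prop :=
  subspace I /\ forall x y, I y -> I (mul x y).

Definition simple_left_ideal E (mul : E -> E -> E) (I : set E) : Prop :=
  [/\ left_ideal mul I, I != [set 0]
    & forall J, left_ideal mul J -> J `<=` I -> J = [set 0] \/ J = I].

Definition semisimple E (mul : E -> E -> E) : Prop :=
  lin_span (\bigcup_(I in simple_left_ideal mul) I) = [set: E].

Section Quotient.
Variables (E : lmodType K) (S : set E).

Lemma span0 : lin_span S 0.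
Proof.
exists 0%N, (fun=> 0), (fun=> 0); split; first by case.
by rewrite big_ord0.
Qed.

Lemma spanP c x y : lin_span S x -> lin_span S y -> lin_span S (c *: x + y).
Proof.
move=> [n [a [u [Su ->]]]] [m [b [v [Sv ->]]]].
pose s (k : 'I_(n + m)) := fintype.split k.
exists (n + m)%N,
  (fun k => match s k with inl i => c * a i | inr j => b j end),
  (fun k => match s k with inl i => u i | inr j => v j end); split.
  by move=> k; case: (s k).
rewrite big_split_ord /= scaler_sumr; congr (_ + _); apply: eq_bigr => i _.
  by rewrite /s (unsplitK (inl _ i)) scalerA.
by rewrite /s (unsplitK (inr _ i)).
Qed.

Lemma span_opp x : lin_span S x -> lin_span S (- x).
Proof. by move=> Sx; rewrite -[- x]addr0 -scaleN1r; apply: spanP => //; exact: span0. Qed.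

Lemma span_add x y : lin_span S x -> lin_span S y -> lin_span S (x + y).
Proof. by move=> Sx Sy; rewrite -[x]scale1r; apply: spanP. Qed.

Lemma span_scale c x : lin_span S x -> lin_span S (c *: x).
Proof. by move=> Sx; rewrite -[_ *: _]addr0; apply: spanP => //; exact: span0. Qed.

Definition span_rel (x y : E) : bool := `[< lin_span S (x - y) >].

Lemma span_rel_equiv : equiv_class_of span_rel.
Proof.
constructor=> [x|x y|y x z].
- by rewrite /span_rel subrr; apply/asboolP; exact: span0.
- by apply/asboolP/asboolP => /span_opp; rewrite opprB.
- move=> /asboolP xy /asboolP yz; apply/asboolP.
  by have := span_add xy yz; rewrite addrA subrK.
Qed.

Canonical span_equiv := EquivRelPack span_rel_equiv.
Canonical span_encModRel := defaultEncModRel span_rel.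

Definition quot_span := {eq_quot span_rel}.

HB.instance Definition _ := Choice.on quot_span.
HB.instance Definition _ := EqQuotient.on quot_span.

Definition qzero : quot_span := lift_cst quot_span 0.
Definition qadd := lift_op2 quot_span (@GRing.add E).
Definition qopp := lift_op1 quot_span (@GRing.opp E).
Definition qscale (c : K) := lift_op1 quot_span (fun x : E => c *: x).

Lemma quotP (x y : E) : (\pi_quot_span x = \pi_quot_span y) <-> lin_span S (x - y).
Proof. by split=> [/eqmodP/asboolP|xy]; last exact/eqmodP/asboolP. Qed.

Lemma qaddE x y : qadd (\pi x) (\pi y) = \pi_quot_span (x + y).
Proof.
unlock qadd; apply/quotP; rewrite opprD addrACA.
by apply: span_add; apply/quotP; rewrite reprK.
Qed.

Lemma qoppE x : qopp (\pi x) = \pi_quot_span (- x).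
Proof.
unlock qopp; apply/quotP; rewrite -opprD.
by apply/span_opp/quotP; rewrite reprK.
Qed.

Lemma qscaleE c x : qscale c (\pi x) = \pi_quot_span (c *: x).
Proof.
unlock qscale; apply/quotP; rewrite -scalerBr.
by apply/span_scale/quotP; rewrite reprK.
Qed.

Lemma qzeroE : qzero = \pi_quot_span 0. Proof. by unlock qzero. Qed.

Lemma qaddA : associative qadd.
Proof. by elim/quotW=> x; elim/quotW=> y; elim/quotW=> z; rewrite !qaddE addrA. Qed.

Lemma qaddC : commutative qadd.
Proof. by elim/quotW=> x; elim/quotW=> y; rewrite !qaddE addrC. Qed.

Lemma qadd0 : left_id qzero qadd.
Proof. by elim/quotW=> x; rewrite qzeroE qaddE add0r. Qed.

Lemma qaddN : left_inverse qzero qopp qadd.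
Proof. by elim/quotW=> x; rewrite qoppE qaddE addNr qzeroE. Qed.

HB.instance Definition _ :=
  GRing.isZmodule.Build quot_span qaddA qaddC qadd0 qaddN.

Lemma qscaleA (a b : K) (v : quot_span) : qscale a (qscale b v) = qscale (a * b) v.
Proof. by elim/quotW: v => x; rewrite !qscaleE scalerA. Qed.

Lemma qscale1 : left_id 1 qscale.
Proof. by elim/quotW=> x; rewrite qscaleE scale1r. Qed.

Lemma qscaleDr : right_distributive qscale +%R.
Proof.
move=> c; elim/quotW=> x; elim/quotW=> y.
by rewrite /GRing.add /= qaddE !qscaleE qaddE scalerDr.
Qed.

Lemma qscaleDl (v : quot_span) : {morph qscale^~ v : a b / a + b}.
Proof.
by elim/quotW: v => x a b; rewrite [in RHS]/GRing.add /= !qscaleE qaddE scalerDl.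
Qed.

HB.instance Definition _ :=
  GRing.Zmodule_isLmodule.Build K quot_span qscaleA qscale1 qscaleDr qscaleDl.

End Quotient.
End LinearAlgebra.

Section VertexOperatorAlgebras.
Variable K : numFieldType.

(* YM a n is the mode a(n): Y_M(a, z) = \sum_n a(n) z^(-n-1) *)

Definition bilinear_modes (V M : lmodType K) (YM : V -> int -> M -> M) : Prop :=
  (forall n u, linear (fun a => YM a n u)) /\ (forall a n, linear (YM a n)).

(* Y_M(a, z) u is a formal Laurent series with finitely many negative powers *)
Definition truncated (V M : lmodType K) (YM : V -> int -> M -> M) : Prop :=
  forall a u, exists N : int, forall n, N <= n -> YM a n u = 0.

Definition vacuum_acts_as_id (V M : lmodType K) (vac : V)
    (YM : V -> int -> M -> M) : Prop :=
  forall n u, YM vac n u = if n == -1 then u else 0.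

(* The coefficient of z0^(-l-1) z1^(-m-1) z2^(-n-1) in the Jacobi identity     *)
(* applied to u; all the sums have finite support when Y and YM are truncated. *)
Definition jacobi (V M : lmodType K) (Y : V -> int -> V -> V)
    (YM : V -> int -> M -> M) : Prop :=
  forall (a b : V) (u : M) (l m n : int),
    \sum_(i \in [set: nat]) ((-1) ^+ i * gbinom K l i) *:
       YM a (m + l - i%:Z) (YM b (n + i%:Z) u)
  - \sum_(i \in [set: nat]) ((-1) ^ l * (-1) ^+ i * gbinom K l i) *:
       YM b (n + l - i%:Z) (YM a (m + i%:Z) u)
  = \sum_(i \in [set: nat]) gbinom K m i *:
       YM (Y a (l + i%:Z) b) (m + n - i%:Z) u.

Record voa := VOA {
  voa_space :> lmodType K;
  voa_Y : voa_space -> int -> voa_space -> voa_space;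
  vac : voa_space;
  conf : voa_space;
  central_charge : K;
  voa_bilinear : bilinear_modes voa_Y;
  voa_truncated : truncated voa_Y;
  voa_vacuum : vacuum_acts_as_id vac voa_Y;
  voa_creation : forall a (n : nat),
    voa_Y a n%:Z vac = 0 /\ voa_Y a (-1) vac = a;
  voa_jacobi : jacobi voa_Y voa_Y;
  voa_virasoro : forall (m n : int) (v : voa_space),
    let L k := voa_Y conf (k + 1) in
    L m (L n v) - L n (L m v) =
      (m - n)%:~R *: L (m + n) v
      + (if m + n == 0
         then ((m ^+ 3 - m)%:~R / 12%:R * central_charge) *: v else 0);
  voa_derivative : forall a (n : int) (v : voa_space),
    voa_Y (voa_Y conf 0 a) n v = - n%:~R *: voa_Y a (n - 1) v;
  voa_grading :
    direct_sum (fun n : int => eig_space (voa_Y conf 1) n%:~R);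
  voa_finite_dim : forall n : int,
    finite_dim (eig_space (voa_Y conf 1) n%:~R);
  voa_bounded_below : exists N : int, forall n : int, n < N ->
    eig_space (voa_Y conf 1) n%:~R = [set 0]
}.

Definition voa_wt (V : voa) (n : int) : set V :=
  eig_space (voa_Y (conf V) 1) n%:~R.

Section Zhu.
Variable V : voa.

(* Res_z (1 + z)^k / z^2 Y(a, z) b, with k the weight of a *)
Definition zhu_circ (k : int) (a b : V) : V :=
  \sum_(i \in [set: nat]) gbinom K k i *: voa_Y a (i%:Z - 2) b.

(* Res_z (1 + z)^k / z Y(a, z) b, with k the weight of a *)
Definition zhu_star_hom (k : int) (a b : V) : V :=
  \sum_(i \in [set: nat]) gbinom K k i *: voa_Y a (i%:Z - 1) b.

Definition zhu_star (a b : V) : V :=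
  \sum_(k \in [set: int]) zhu_star_hom k (component (@voa_wt V) k a) b.

(* O(V) is the span of zhu_O_gen *)
Definition zhu_O_gen : set V :=
  [set v | exists k a b, voa_wt k a /\ v = zhu_circ k a b].

Definition zhu_algebra := quot_span zhu_O_gen.

HB.instance Definition _ := GRing.Lmodule.on zhu_algebra.

(* The class of x * y for representatives x and y; by a theorem of Zhu it does *)
(* not depend on the representatives.                                          *)
Definition zhu_mul : zhu_algebra -> zhu_algebra -> zhu_algebra :=
  lift_op2 zhu_algebra zhu_star.

End Zhu.

Record weak_module (V : voa) := WeakModule {
  wm_space :> lmodType K;
  wm_Y : V -> int -> wm_space -> wm_space;
  wm_bilinear : bilinear_modes wm_Y;
  wm_truncated : truncated wm_Y;
  wm_vacuum : vacuum_acts_as_id (vac V) wm_Y;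
  wm_jacobi : jacobi (@voa_Y V) wm_Y
}.

Definition vir_L (V : voa) (M : weak_module V) (n : int) : M -> M :=
  wm_Y (conf V) (n + 1).

Definition extend_grading (E : lmodType K) (G : nat -> set E) (k : int) : set E :=
  if k is Posz n then G n else [set 0].

Record admissible_module (V : voa) := AdmissibleModule {
  am_weak :> weak_module V;
  am_deg : nat -> set am_weak;
  am_grading : direct_sum am_deg;
  am_degree : forall (k : int) (a : V) (n : int) (m : nat) (u : am_weak),
    voa_wt k a -> am_deg m u ->
    extend_grading am_deg (k + m%:Z - n - 1) (wm_Y a n u)
}.

Section Admissible.
Variables (V : voa) (M : admissible_module V).

Definition degree_op (u : M) : M :=
  \sum_(n \in [set: nat]) n%:R *: component (@am_deg V M) n u.

Definition admissible_submodule (N : set M) : Prop :=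
  [/\ subspace N,
      forall (a : V) (n : int) (u : M), N u -> N (wm_Y a n u)
    & forall u : M, N u -> N (degree_op u)].

Definition irreducible_module : Prop :=
  [set: M] != [set 0] /\
  forall N, admissible_submodule N -> N = [set 0] \/ N = [set: M].

Definition is_lowest_weight (lam : K) : Prop :=
  direct_sum (fun n : nat => eig_space (@vir_L V M 0) (lam + n%:R)) /\
  eig_space (@vir_L V M 0) lam != [set 0].

End Admissible.

Definition lowest_weights (V : voa) : set K :=
  [set lam | exists M : admissible_module V,
     irreducible_module M /\ is_lowest_weight M lam].

End VertexOperatorAlgebras.

(* Main.v *)
From HB Require Import structures.
Require Import Defs.
From mathcomp Require Import all_boot all_order all_algebra.
From mathcomp Require Import boolp classical_sets functions cardinality fsbigop reals.
From mathcomp Require Import zify.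

(** Suppose that [M] has a nonzero generalized [L(0)]-eigenvector of eigenvalue
    [lam]; we produce an irreducible admissible module whose lowest weight [mu]
    satisfies [lam = mu + n] with [n] in [nat].

    Every homogeneous component of an [L(0)]-eigenvector is again an eigenvector,
    since [L(0)] preserves the degree; so there is an eigenvector [w] of eigenvalue
    [lam], homogeneous of some degree [n0] ([homogeneous_eigenvector]).  The relation
    [[L(0), a(n)] = (wt a - n - 1) a(n)] ([L0_mode]) says that modes shift degree
    and [L(0)]-eigenvalue by the same amount.  Hence, with [c = lam - n0], the
    sum of the spaces of vectors of degree [i] and eigenvalue [c + i] is a
    submodule ([coherent_part_submodule]); it contains [w], and therefore the
    whole submodule [T] generated by [w].  So [L(0)] is diagonalizable on [T],
    and its eigenvalues lie in [c + nat].

    By Zorn's lemma, [T] has a submodule [S] maximal among those avoiding [w]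
    ([maximal_submodule_avoiding]).  As [w] generates [T], the quotient [T / S] is
    simple even as a weak module.  It is still spanned by eigenvectors with
    eigenvalues in [c + nat], and the image of [w] is nonzero of eigenvalue
    [lam = c + n0].  Let [mu = c + m] be the smallest eigenvalue that occurs
    ([lowest_eigenvalue]); then [m <= n0], and the eigenspaces of [mu + i] grade
    [T / S] as an admissible module ([L0_graded_module]).  It is irreducible of
    lowest weight [mu], and [lam = mu + (n0 - m)]. *)

Set Implicit Arguments.
Unset Strict Implicit.
Unset Printing Implicit Defensive.
Import Order.TTheory GRing.Theory Num.Theory.
Local Open Scope classical_set_scope.
Local Open Scope ring_scope.
Local Open Scope complex_scope.

(** * Finite sums and binomial coefficients *)

Section FiniteSums.
Variable E : nmodType.

Lemma fsum_nat_ord (F : nat -> E) (N : nat) :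
  (forall i, (N <= i)%N -> F i = 0) ->
  \sum_(i \in [set: nat]) F i = \sum_(i < N) F i.
Proof.
move=> F0; rewrite fsbig_ord; apply/esym/fsbig_widen => // i [_ /= /negP].
by rewrite -leqNgt => /F0.
Qed.

Lemma fsum_single (F : nat -> E) (j : nat) :
  (forall i, i != j -> F i = 0) -> \sum_(i \in [set: nat]) F i = F j.
Proof.
move=> F0; transitivity (\sum_(i \in [set j]) F i); last by rewrite fsbig_set1.
by apply/esym/fsbig_widen => // i [_ /= /eqP /F0].
Qed.

End FiniteSums.

Section GeneralizedBinomials.
Variable K : numFieldType.

Lemma gbinom_nat (m i : nat) : gbinom K m i = 'C(m, i)%:R.
Proof.
apply: (mulIf (x := i`!%:R)); first by rewrite pnatr_eq0 -lt0n fact_gt0.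
rewrite /gbinom divfK ?pnatr_eq0 -?lt0n ?fact_gt0 // -natrM bin_ffact.
elim: i => [|i IHi]; first by rewrite big_ord0.
rewrite big_ord_recr /= IHi ffactnSr natrM.
case: (leqP i m) => [im|mi]; first by rewrite natrB.
by rewrite ffact_small // !mul0r.
Qed.

(** These are the coefficients of [(1 - z)^(-2)]. *)
Lemma gbinomN2 (i : nat) : (-1) ^+ i * gbinom K (- 2) i = i.+1%:R.
Proof.
rewrite /gbinom mulrA -[X in X * _]mulr1.
have -> : (-1) ^+ i * \prod_(j < i) ((- 2)%:~R - j%:R) = (i.+1)`!%:R :> K.
  elim: i => [|i IHi]; first by rewrite big_ord0 mulr1.
  rewrite big_ord_recr /= exprSr mulrACA IHi [in RHS]factS natrM mulrC; congr (_ * _).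
  by rewrite mulN1r opprB mulrNz opprK -natrD addn2.
by rewrite mulr1 factS natrM mulfK // pnatr_eq0 -lt0n fact_gt0.
Qed.

End GeneralizedBinomials.

(** * Commutation of L(0) with modes *)

Section ModeAlgebra.
Variables (K : numFieldType) (V : voa K).

HB.instance Definition _ (a : V) (n : int) :=
  GRing.isLinear.Build K V V *:%R (@voa_Y K V a n) ((voa_bilinear V).2 a n).

HB.instance Definition _ (M : weak_module V) (a : V) (n : int) :=
  GRing.isLinear.Build K M M *:%R (@wm_Y K V M a n) ((wm_bilinear M).2 a n).

(** Since [L(-2) 1 = conf], this is [[L(0), L(-2)] = 2 L(-2)] applied to the
    vacuum, which [L(0)] kills; no central term arises. *)
Lemma conf_weight : voa_wt 2 (conf V).
Proof.
have [Lvac0 _] := voa_creation (conf V) 1.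
have [_ Lvac] := voa_creation (conf V) 0.
by have := voa_virasoro 0 (-2) (vac V); rewrite /= Lvac0 Lvac linear0 subr0 addr0.
Qed.

(** [L(-1) a = a(-2) 1]: the derivation property at [n = -1], applied to the
    vacuum, where the creation axiom reads [b(-1) 1 = b]. *)
Lemma conf_mode0 (a : V) : voa_Y (conf V) 0 a = voa_Y a (-2) (vac V).
Proof.
have [_ <-] := voa_creation (voa_Y (conf V) 0 a) 0.
by rewrite voa_derivative opprK scale1r.
Qed.

Variable M : weak_module V.

(** The mode as a function of the algebra element, so that it can carry a
    linear structure. *)
Definition mode_at (n : int) (u : M) (a : V) : M := wm_Y a n u.

HB.instance Definition _ (n : int) (u : M) :=
  GRing.isLinear.Build K V M *:%R (mode_at n u) ((wm_bilinear M).1 n u).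

(** The Jacobi identity at [l = 0], where [(z1 - z2)^l] has a single term. *)
Lemma commutator_formula (a b : V) (m n : int) (u : M) :
  wm_Y a m (wm_Y b n u) - wm_Y b n (wm_Y a m u)
  = \sum_(i \in [set: nat]) gbinom K m i *: wm_Y (voa_Y a i%:Z b) (m + n - i%:Z) u.
Proof.
have := wm_jacobi a b u 0 m n.
rewrite [X in X - _](fsum_single (j := 0%N)) => [|[|i] // _]; last first.
  by rewrite (gbinom_nat K 0) bin0n /= mulr0 scale0r.
rewrite [X in _ - X](fsum_single (j := 0%N)) => [|[|i] // _]; last first.
  by rewrite (gbinom_nat K 0) bin0n /= mulr0 scale0r.
rewrite (gbinom_nat K 0) bin0 !mulr1 expr0 !scale1r !subr0.
by move=> ->; apply: eq_fsbigr => i _; rewrite add0r.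
Qed.

(** The derivation property of [L(-1)] on a module is a case of the
    Jacobi identity, for [a] and the vacuum at [l = -2], [m = 0].  On the left a
    mode of the vacuum occurs in each term, so at most one term survives: in
    the first sum if [n < 0], in the second if [n > 0]. *)
Lemma translation_mode (a : V) (n : int) (u : M) :
  wm_Y (voa_Y a (-2) (vac V)) n u = - n%:~R *: wm_Y a (n - 1) u.
Proof.
have := wm_jacobi a (vac V) u (-2) 0 n.
rewrite [X in _ = X](fsum_single (j := 0%N)); last first.
  by move=> [|i] // _; rewrite (gbinom_nat K 0) bin0n /= scale0r.
rewrite (gbinom_nat K 0) bin0 scale1r !add0r addr0 subr0 => <-.
have sgn2 : (-1) ^ (-2) = 1 :> K by rewrite /exprz /= sqrrN expr1n invr1.
have vac0 (m : int) (v : M) : m != -1 -> wm_Y (vac V) m v = 0.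
  by rewrite wm_vacuum => /negbTE ->.
have vac1 (m : int) (v : M) : m = -1 -> wm_Y (vac V) m v = v.
  by move=> ->; rewrite wm_vacuum eqxx.
case: n => [[|j]|j].
- rewrite !fsbig1 => [|i _|i _].
  + by rewrite subr0 mulr0z oppr0 scale0r.
  + by rewrite vac0 ?scaler0 //; lia.
  + by rewrite vac0 ?linear0 ?scaler0 //; lia.
- rewrite fsbig1 => [|i _]; last by rewrite vac0 ?linear0 ?scaler0 //; lia.
  rewrite (fsum_single (j := j)) => [|i ij]; last first.
    by rewrite vac0 ?scaler0 //; lia.
  rewrite vac1; last by lia.
  rewrite sgn2 mul1r gbinomN2 sub0r scaleNr; congr (- (_ *: wm_Y _ _ _)); lia.
- rewrite [X in _ - X]fsbig1 => [|i _]; last by rewrite vac0 ?scaler0 //; lia.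
  rewrite (fsum_single (j := j)) => [|i ij]; last first.
    by rewrite vac0 ?linear0 ?scaler0 //; lia.
  rewrite vac1; last by lia.
  rewrite gbinomN2 subr0 NegzE mulrNz opprK; congr (_ *: wm_Y _ _ _); lia.
Qed.

(** The commutator formula for [L(0) = omega(1)] has the two terms
    [(L(-1) a)(n+1) = - (n+1) a(n)] and [(L(0) a)(n) = (wt a) a(n)]. *)
Lemma L0_mode (k : int) (a : V) (n : int) (u : M) : voa_wt k a ->
  vir_L 0 (wm_Y a n u) = wm_Y a n (vir_L 0 u) + (k - n - 1)%:~R *: wm_Y a n u.
Proof.
move=> ka; rewrite /vir_L add0r; apply/eqP; rewrite addrC -subr_eq; apply/eqP.
rewrite commutator_formula (fsum_nat_ord (N := 2)) => [|i i2]; last first.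
  by rewrite (gbinom_nat K 1) bin_small ?scale0r.
rewrite !big_ord_recr big_ord0 /= !(gbinom_nat K 1) bin0 bin1 !scale1r add0r.
rewrite conf_mode0 translation_mode ka -[X in _ + X]/(mode_at _ _ _) linearZ /=.
rewrite /mode_at subr0 (_ : 1 + n - 1 = n); last by lia.
by rewrite -mulrNz -scalerDl -intrD; congr (_%:~R *: _); lia.
Qed.

End ModeAlgebra.

(** * Sums of eigenspaces *)

Section GradedSums.
Variables (K : numFieldType) (E : lmodType K).
Implicit Types (S : set E) (G : nat -> set E).

Lemma subspaceD S x y : subspace S -> S x -> S y -> S (x + y).
Proof. by move=> [_ SL] Sx Sy; rewrite -[x]scale1r; apply: SL. Qed.

Lemma subspaceZ S c x : subspace S -> S x -> S (c *: x).
Proof. by move=> [S0 SL] Sx; rewrite -[_ *: _]addr0; apply: SL. Qed.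

Lemma subspaceB S x y : subspace S -> S x -> S y -> S (x - y).
Proof. by move=> [_ SL] Sx Sy; rewrite addrC -scaleN1r; apply: SL. Qed.

Lemma subspace_sum S (I : Type) (r : seq I) (P : pred I) (F : I -> E) :
  subspace S -> (forall i, P i -> S (F i)) -> S (\sum_(i <- r | P i) F i).
Proof.
move=> hS SF; apply: big_ind => //; first by case: hS.
by move=> x y; apply: subspaceD.
Qed.

Lemma subspace0 : subspace [set (0 : E)].
Proof. by split=> // c x y -> ->; rewrite scaler0 addr0. Qed.

Lemma subspaceI S S' : subspace S -> subspace S' -> subspace (S `&` S').
Proof.
move=> [S0 SL] [S'0 S'L]; split=> // c x y [Sx S'x] [Sy S'y].
by split; [apply: SL|apply: S'L].
Qed.

Lemma subspace_eig (T : {linear E -> E}) (c : K) : subspace (eig_space T c).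
Proof.
split=> [|a x y]; rewrite /eig_space /=; first by rewrite linear0 scaler0.
by move=> Tx Ty; rewrite linearP Tx Ty scalerDr !scalerA mulrC.
Qed.

(** The algebraic sum of the [G i].  A bound [m] on the indices together with a
    function on all of [nat] makes it easy to pad and shift decompositions. *)
Definition graded_sum G : set E :=
  [set x | exists (m : nat) (f : nat -> E),
    (forall i, G i (f i)) /\ x = \sum_(i < m) f i].

Lemma graded_sum_subspace G :
  (forall i, subspace (G i)) -> subspace (graded_sum G).
Proof.
move=> hG; split=> [|c x y [p [f [Gf ->]]] [q [g [Gg ->]]]].
  by exists 0%N, (fun=> 0); split=> [i|]; [case: (hG i)|rewrite big_ord0].
exists (maxn p q), (fun i => c *: (if (i < p)%N then f i else 0)
                            + (if (i < q)%N then g i else 0)).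
split=> [i|].
  by apply: (hG i).2; case: ifP => // _; case: (hG i).
rewrite big_split /= -scaler_sumr -!big_mkcond /=.
by rewrite -!big_ord_widen ?leq_maxl ?leq_maxr.
Qed.

Lemma graded_sum_sub G i : (forall i, G i 0) -> G i `<=` graded_sum G.
Proof.
move=> G0 x Gx; exists i.+1, (fun j => if j == i then x else 0); split=> [j|].
  by case: eqP => // ->.
rewrite big_ord_recr /= eqxx big1 ?add0r // => j _.
by rewrite ltn_eqF.
Qed.

Lemma finite_support_bound (f : nat -> E) :
  finite_set [set i | f i != 0] ->
  exists N, forall i, (N <= i)%N -> f i = 0.
Proof.
move=> /finite_seqP[s sE]; exists (\max_(i <- s) i).+1 => i Ni.
apply/eqP/negPn/negP => fi.
have is_ : i \in s by have : [set` s] i by rewrite -sE.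
by move: Ni; rewrite ltnNge leq_bigmax_seq.
Qed.

Lemma direct_sum_eq0 G (m : nat) (f : nat -> E) :
  direct_sum G -> (forall i, G i (f i)) -> \sum_(i < m) f i = 0 ->
  forall i, (i < m)%N -> f i = 0.
Proof.
move=> [hG uniqG] Gf f0 i im.
have [g [_ gP]] := uniqG 0.
have dec0 : is_decomposition G 0 (fun=> 0).
  split=> [j||]; first by case: (hG j).
    by rewrite (_ : [set _ | _] = set0) ?finite_set0 // -subset0 => j /=; rewrite eqxx.
  by rewrite fsbig1.
pose f' j := if (j < m)%N then f j else 0.
have decf : is_decomposition G 0 f'.
  split=> [j||]; first by rewrite /f'; case: ifP => // _; case: (hG j).
    apply: (@sub_finite_set _ _ `I_m); last exact: finite_II.
    by move=> j /=; rewrite /f'; case: ifP => // _; rewrite eqxx.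
  rewrite (fsum_nat_ord (N := m)) => [|j mj]; last by rewrite /f' ltnNge mj.
  by rewrite -[LHS]f0; apply: eq_bigr => j _; rewrite /f' ltn_ord.
have : f' i = 0 by rewrite -(gP _ decf) (gP _ dec0).
by rewrite /f' im.
Qed.

Lemma direct_sum_graded_sum G : direct_sum G -> graded_sum G = [set: E].
Proof.
move=> [hG uniqG]; apply/seteqP; split=> // x _.
have [f [[Gf finf ->] _]] := uniqG x.
have [N fN] := finite_support_bound finf.
by exists N, f; split; rewrite // (fsum_nat_ord fN).
Qed.

Lemma graded_sum_direct G :
  (forall i, subspace (G i)) -> graded_sum G = [set: E] ->
  (forall m f, (forall i, G i (f i)) -> \sum_(i < m) f i = 0 ->
    forall i, (i < m)%N -> f i = 0) ->
  direct_sum G.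
Proof.
move=> hG Gtot Gfree; split=> // u.
have [m [f [Gf uE]]] : graded_sum G u by rewrite Gtot.
pose f' j := if (j < m)%N then f j else 0.
have f'0 j : (m <= j)%N -> f' j = 0 by rewrite /f' ltnNge => ->.
exists f'; split.
  split=> [j||]; first by rewrite /f'; case: ifP => // _; case: (hG j).
    apply: (@sub_finite_set _ _ `I_m); last exact: finite_II.
    by move=> j /=; rewrite /f'; case: ifP => // _; rewrite eqxx.
  by rewrite (fsum_nat_ord f'0) uE; apply: eq_bigr => j _; rewrite /f' ltn_ord.
move=> g [Gg fing gE]; have [N gN] := finite_support_bound fing.
apply/funext => i; apply/eqP; rewrite -subr_eq0; apply/eqP.
have [iN|iN] := ltnP i (maxn m N); last first.
  by move: iN; rewrite geq_max => /andP[mi Ni]; rewrite f'0 // gN // subr0.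
apply: (Gfree (maxn m N) (fun i => f' i - g i)) => // [j|].
  apply: subspaceB => //; rewrite /f'; case: ifP => // _; by case: (hG j).
rewrite sumrB -fsum_nat_ord => [|j]; last by rewrite geq_max => /andP[/f'0].
rewrite -fsum_nat_ord => [|j]; last by rewrite geq_max => /andP[_ /gN].
rewrite -gE (fsum_nat_ord f'0) uE; apply/eqP; rewrite subr_eq0; apply/eqP.
by apply: eq_bigr => j _; rewrite /f' ltn_ord.
Qed.

Section Eigenspaces.
Variables (T : {linear E -> E}) (c : nat -> K).
Hypothesis c_inj : injective c.

(** By induction on the number of components: for the sum [x] of [f 0], [f 1], up
    to [f m], the vector [T x - c m *: x] lies in [S] and has one component fewer,
    each of them rescaled by a nonzero [c i - c m]. *)
Lemma eigen_components S (m : nat) (f : nat -> E) :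
  subspace S -> (forall x, S x -> S (T x)) ->
  (forall i, eig_space T (c i) (f i)) -> S (\sum_(i < m) f i) ->
  forall i, (i < m)%N -> S (f i).
Proof.
move=> hS ST; elim: m f => // m IHm f Tf Sf.
have Slow i : (i < m)%N -> S (f i).
  move=> im; have cim : c i - c m != 0.
    by rewrite subr_eq0; apply/eqP => /c_inj im'; rewrite im' ltnn in im.
  rewrite -[f i]scale1r -(mulVf cim) -scalerA; apply: subspaceZ => //.
  apply: (IHm (fun i => (c i - c m) *: f i)) im => [j|].
    by rewrite /eig_space /= linearZ /= Tf !scalerA mulrC.
  have -> : \sum_(j < m) (c j - c m) *: f j =
            T (\sum_(j < m.+1) f j) - c m *: \sum_(j < m.+1) f j.
    rewrite linear_sum scaler_sumr -sumrB big_ord_recr /= Tf subrr addr0.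
    by apply: eq_bigr => j _; rewrite Tf scalerBl.
  by apply: subspaceB => //; [apply: ST|apply: subspaceZ].
move=> i; rewrite ltnS leq_eqVlt => /orP[/eqP ->|]; last exact: Slow.
rewrite (_ : f m = \sum_(j < m.+1) f j - \sum_(j < m) f j).
  by apply: subspaceB => //; apply: subspace_sum => // j _; apply: Slow.
by rewrite big_ord_recr /= addrAC subrr add0r.
Qed.

Lemma eigen_direct_sum :
  graded_sum (fun i => eig_space T (c i)) = [set: E] ->
  direct_sum (fun i => eig_space T (c i)).
Proof.
move=> tot; apply: graded_sum_direct => // [i|m f Tf f0 i im].
  exact: subspace_eig.
apply: (@eigen_components [set 0] m f) im => //; first exact: subspace0.
by move=> x ->; rewrite /= linear0.
Qed.

(** The components of [x] lie in the [T]-stable subspace [eig_space T e], yet have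
    eigenvalues [c i != e]. *)
Lemma eigenvector_eq0 (e : K) (x : E) :
  graded_sum (fun i => eig_space T (c i)) x ->
  eig_space T e x -> (forall i, c i != e) -> x = 0.
Proof.
move=> [m [f [Tf xE]]] Tx ce; rewrite xE big1 // => i _.
have ei : eig_space T e (f i).
  apply: (@eigen_components _ m f (subspace_eig T e)) => //; last by rewrite -xE.
  by move=> y /= Ty; rewrite /eig_space /= Ty linearZ /= Ty.
have /eqP : c i *: f i - e *: f i = 0 by rewrite -[c i *: _]Tf ei subrr.
by rewrite -scalerBl scaler_eq0 subr_eq0 (negbTE (ce i)) => /eqP.
Qed.

End Eigenspaces.
End GradedSums.

(** * Submodules and quotients of weak modules *)

Section SubLmodule.
Variables (K : numFieldType) (E : lmodType K) (S : set E) (hS : subspace S).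

(** The proof argument lets the closure instances below be found by inference. *)
Definition sub_mem (_ : subspace S) : pred E := fun x => `[< S x >].

Fact sub_mem_closed : GRing.subsemimod_closed (sub_mem hS).
Proof.
split; first split.
- by apply/asboolP; case: hS.
- by move=> x y /asboolP Sx /asboolP Sy; apply/asboolP; apply: subspaceD.
- by move=> c x /asboolP Sx; apply/asboolP; apply: subspaceZ.
Qed.

HB.instance Definition _ :=
  GRing.isSubmodClosed.Build K E (sub_mem hS) sub_mem_closed.

Definition sub_space := {x : E | x \in sub_mem hS}.

HB.instance Definition _ := SubType.on sub_space.
HB.instance Definition _ := Choice.on sub_space.
HB.instance Definition _ := [SubChoice_isSubLmodule of sub_space by <:].

Definition to_sub (x : E) (Sx : S x) : sub_space := exist _ x (asboolT Sx).

Lemma sub_spaceP (x : sub_space) : S (val x).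
Proof. by apply/asboolP; exact: (valP x). Qed.

End SubLmodule.

Section QuotientLmodule.
Local Open Scope quotient_scope.
Variables (K : numFieldType) (E : lmodType K) (S : set E).

Definition quot_proj (x : E) : quot_span S := \pi x.

Fact quot_proj_linear : linear quot_proj.
Proof. by move=> c x y; rewrite /quot_proj -qaddE -qscaleE. Qed.

HB.instance Definition _ :=
  GRing.isLinear.Build K E (quot_span S) *:%R quot_proj quot_proj_linear.

Lemma quot_proj_surj (q : quot_span S) : exists x, q = quot_proj x.
Proof. by elim/quotW: q => x; exists x. Qed.

Lemma lin_span_subspace : subspace S -> lin_span S = S.
Proof.
move=> hS; apply/seteqP; split=> [x [n [c [f [Sf ->]]]]|x Sx].
  by apply: subspace_sum => // i _; apply: subspaceZ.
exists 1%N, (fun=> 1), (fun=> x); split=> //.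
by rewrite big_ord_recr big_ord0 /= scale1r add0r.
Qed.

Lemma quot_proj_eq (x y : E) :
  subspace S -> quot_proj x = quot_proj y <-> S (x - y).
Proof. by move=> hS; have := Defs.quotP S x y; rewrite lin_span_subspace. Qed.

Lemma quot_proj_eq0 (x : E) : subspace S -> quot_proj x = 0 <-> S x.
Proof. by move=> hS; have := quot_proj_eq x 0 hS; rewrite linear0 subr0. Qed.

End QuotientLmodule.

Section Intertwiners.
Variables (K : numFieldType) (V : voa K).

(** The defect of the Jacobi identity, so that the identity can be carried
    along a linear map as a single equation. *)
Definition jacobiator (M : lmodType K) (YM : V -> int -> M -> M)
    (a b : V) (l m n : int) (u : M) : M :=
  \sum_(i \in [set: nat]) ((-1) ^+ i * gbinom K l i) *:
     YM a (m + l - i%:Z) (YM b (n + i%:Z) u)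
  - \sum_(i \in [set: nat]) ((-1) ^ l * (-1) ^+ i * gbinom K l i) *:
     YM b (n + l - i%:Z) (YM a (m + i%:Z) u)
  - \sum_(i \in [set: nat]) gbinom K m i *:
     YM (voa_Y a (l + i%:Z) b) (m + n - i%:Z) u.

Lemma truncated_nat (M : lmodType K) (YM : V -> int -> M -> M) a u (n : int) :
  truncated YM -> exists N : nat, forall i : nat, (N <= i)%N -> YM a (n + i%:Z) u = 0.
Proof.
move=> tr; have [N YN] := tr a u.
by exists (absz (N - n)) => i Ni; apply: YN; lia.
Qed.

Lemma linear_fsum (M M' : lmodType K) (p : {linear M -> M'}) (F : nat -> M) N :
  (forall i, (N <= i)%N -> F i = 0) ->
  p (\sum_(i \in [set: nat]) F i) = \sum_(i \in [set: nat]) p (F i).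
Proof.
move=> F0; rewrite (fsum_nat_ord F0) linear_sum (fsum_nat_ord (N := N)) // => i Ni.
by rewrite F0 ?linear0.
Qed.

Variables (M M' : lmodType K) (p : {linear M -> M'}).
Variables (YM : V -> int -> M -> M) (YM' : V -> int -> M' -> M').
Hypothesis pY : forall a n u, p (YM a n u) = YM' a n (p u).

(** Truncation in the source is what allows [p] to pass through the sums. *)
Lemma jacobiator_intertwined :
  bilinear_modes YM -> truncated YM -> forall a b l m n u,
  p (jacobiator YM a b l m n u) = jacobiator YM' a b l m n (p u).
Proof.
move=> [YMl YMr] tr a b l m n u.
have Y0r c k : YM c k 0 = 0.
  by have := YMr c k (-1) 0 0; rewrite scaler0 addr0 scaleN1r addNr.
have Y0l k v : YM 0 k v = 0.
  by have := YMl k v (-1) 0 0; rewrite scaler0 addr0 scaleN1r addNr.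
have [Nb Yb] := truncated_nat b u n tr.
have [Na Ya] := truncated_nat a u m tr.
have [Nab Yab] : exists N : nat, forall i : nat, (N <= i)%N -> voa_Y a (l + i%:Z) b = 0.
  by apply: truncated_nat; exact: voa_truncated.
rewrite /jacobiator !linearB /=; congr (_ - _ - _).
- rewrite (@linear_fsum _ _ p _ Nb) => [|i Ni]; last by rewrite Yb // Y0r scaler0.
  by apply: eq_fsbigr => i _; rewrite linearZ /= !pY.
- rewrite (@linear_fsum _ _ p _ Na) => [|i Ni]; last by rewrite Ya // Y0r scaler0.
  by apply: eq_fsbigr => i _; rewrite linearZ /= !pY.
- rewrite (@linear_fsum _ _ p _ Nab) => [|i Ni]; last by rewrite Yab // Y0l scaler0.
  by apply: eq_fsbigr => i _; rewrite linearZ /= !pY.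
Qed.

End Intertwiners.

Lemma jacobiatorP (K : numFieldType) (V : voa K) (M : lmodType K)
    (YM : V -> int -> M -> M) :
  jacobi (@voa_Y K V) YM <-> forall a b l m n u, jacobiator YM a b l m n u = 0.
Proof.
split=> [J a b l m n u|J a b u l m n]; first by rewrite /jacobiator J subrr.
by apply/eqP; rewrite -subr_eq0; apply/eqP; exact: J.
Qed.

Definition weak_submodule (K : numFieldType) (V : voa K) (M : weak_module V)
    (N : set M) : Prop :=
  subspace N /\ forall (a : V) (n : int) (u : M), N u -> N (wm_Y a n u).

Section Subquotients.
Variables (K : numFieldType) (V : voa K) (M : weak_module V).
Implicit Type N : set M.

Section Submodule.
Variables (N : set M) (hN : weak_submodule N).

Definition sub_modes (a : V) (n : int) (x : sub_space hN.1) : sub_space hN.1 :=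
  to_sub hN.1 (hN.2 a n _ (sub_spaceP x)).

Fact sub_bilinear : bilinear_modes sub_modes.
Proof.
split=> [n u|a n] c x y; apply: val_inj; rewrite linearP /=.
  exact: (wm_bilinear M).1.
by rewrite linearP.
Qed.

Fact sub_truncated : truncated sub_modes.
Proof.
move=> a u; have [n0 Y0] := wm_truncated (w := M) a (val u).
by exists n0 => n nn0; apply: val_inj; rewrite /= Y0 // linear0.
Qed.

Fact sub_vacuum : vacuum_acts_as_id (vac V) sub_modes.
Proof.
by move=> n u; apply: val_inj; rewrite /= wm_vacuum; case: ifP; rewrite ?linear0.
Qed.

Fact sub_jacobi : jacobi (@voa_Y K V) sub_modes.
Proof.
apply/jacobiatorP => a b l m n u; apply: val_inj.
rewrite (jacobiator_intertwined (p := val) (YM' := @wm_Y K V M)) //; last first.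
- exact: sub_truncated.
- exact: sub_bilinear.
rewrite linear0; have /jacobiatorP := @wm_jacobi K V M; exact.
Qed.

Definition sub_module : weak_module V :=
  WeakModule sub_bilinear sub_truncated sub_vacuum sub_jacobi.

End Submodule.

Section Quotient.
Variables (N : set M) (hN : weak_submodule N).

Definition quot_modes (a : V) (n : int) (q : quot_span N) : quot_span N :=
  quot_proj N (wm_Y a n (repr q)).

Lemma quot_modesE a n (u : M) :
  quot_modes a n (quot_proj N u) = quot_proj N (wm_Y a n u).
Proof.
apply/(quot_proj_eq _ _ hN.1); rewrite -linearB /=; apply: hN.2.
by apply/(quot_proj_eq _ _ hN.1); rewrite /quot_proj reprK.
Qed.

Fact quot_bilinear : bilinear_modes quot_modes.
Proof.
split=> [n q|a n] c x y.
  have [u ->] := quot_proj_surj q; rewrite !quot_modesE -linearP.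
  by congr (quot_proj N _); exact: (wm_bilinear M).1.
have [u ->] := quot_proj_surj x; have [v ->] := quot_proj_surj y.
by rewrite -linearP !quot_modesE -linearP -linearP.
Qed.

Fact quot_truncated : truncated quot_modes.
Proof.
move=> a q; have [u ->] := quot_proj_surj q.
have [n0 Y0] := wm_truncated (w := M) a u.
by exists n0 => n nn0; rewrite quot_modesE Y0 // linear0.
Qed.

Fact quot_vacuum : vacuum_acts_as_id (vac V) quot_modes.
Proof.
move=> n q; have [u ->] := quot_proj_surj q.
by rewrite quot_modesE wm_vacuum; case: ifP; rewrite ?linear0.
Qed.

Fact quot_jacobi : jacobi (@voa_Y K V) quot_modes.
Proof.
apply/jacobiatorP => a b l m n q; have [u ->] := quot_proj_surj q.
rewrite -(jacobiator_intertwined (p := quot_proj N) (YM := @wm_Y K V M)).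
- by have /jacobiatorP -> := @wm_jacobi K V M; rewrite linear0.
- by move=> c k v; rewrite quot_modesE.
- exact: wm_bilinear.
- exact: wm_truncated.
Qed.

Definition quot_module : weak_module V :=
  WeakModule quot_bilinear quot_truncated quot_vacuum quot_jacobi.

End Quotient.

(** The preimage of a submodule of the quotient is a submodule lying above [S]. *)
Lemma quot_module_simple (S : set M) (hS : weak_submodule S) :
  (forall N, weak_submodule N -> S `<=` N -> N = S \/ N = [set: M]) ->
  forall N : set (quot_module hS), weak_submodule N ->
    N = [set 0] \/ N = [set: quot_module hS].
Proof.
move=> Smax N [hN NY]; pose N' := [set x | N (quot_proj S x)].
have hN' : weak_submodule N'.
  split; first split=> [|b x y Nx Ny].
  - by rewrite /N' /= linear0; exact: hN.1.
  - by rewrite /N' /= linearP; exact: hN.2.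
  - by move=> a n x Nx; rewrite /N' /= -(quot_modesE hS); exact: NY.
have SN' : S `<=` N'.
  by move=> x /(quot_proj_eq0 _ hS.1) x0; rewrite /N' /= x0; exact: hN.1.
case: (Smax _ hN' SN') => N'E; [left|right]; apply/seteqP; split=> q //.
- have [x ->] := quot_proj_surj q => Nx; apply/(quot_proj_eq0 _ hS.1).
  by rewrite -N'E.
- by move=> ->; exact: hN.1.
- have [x ->] := quot_proj_surj q => _.
  by have : [set: M] x by []; rewrite -N'E.
Qed.

Section Generated.
Variable w : M.

Definition generated : set M :=
  \bigcap_(N in [set N : set M | weak_submodule N /\ N w]) N.

Lemma mem_generated : generated w.
Proof. by move=> N []. Qed.

Lemma generated_min N : weak_submodule N -> N w -> generated `<=` N.
Proof. by move=> hN Nw x; apply; split. Qed.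

Lemma generated_submodule : weak_submodule generated.
Proof.
split; first split.
- by move=> N [[[]]].
- move=> b x y Tx Ty N hN; case: (hN) => -[[_ NL] _] _.
  by apply: NL; [apply: Tx|apply: Ty].
- by move=> a n u Tu N hN; case: (hN) => -[_ NY] _; apply: NY; apply: Tu.
Qed.

End Generated.

(** A submodule avoiding the generator [w] and maximal for this property is a
    maximal proper submodule: any larger one contains [w], hence everything. *)
Lemma maximal_submodule_avoiding (w : M) : w <> 0 ->
  (forall N, weak_submodule N -> N w -> N = [set: M]) ->
  exists S, [/\ weak_submodule S, ~ S w
    & forall N, weak_submodule N -> S `<=` N -> N = S \/ N = [set: M]].
Proof.
move=> w0 cyc.
(* The condition 0 \in A is left out, so that the union of the empty chain
   qualifies; a maximal such A contains 0 because [set 0] also qualifies. *)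
pose P (A : set M) := [/\ ~ A w,
  forall (c : K) x y, A x -> A y -> A (c *: x + y)
  & forall (a : V) n x, A x -> A (wm_Y a n x)].
have [F FP totF|S [[Sw SL SY] Smax]] := Zorn_bigcup (P := P).
  split=> [[A /FP[] //]|c x y [A FA Ax] [B FB By]|a n x [A FA Ax]].
  - have [AB|BA] := totF _ _ FA FB.
      by exists B => //; have [_ BL _] := FP _ FB; apply: BL => //; apply: AB.
    by exists A => //; have [_ AL _] := FP _ FA; apply: AL => //; apply: BA.
  - by exists A => //; have [_ _ AY] := FP _ FA; apply: AY.
have P0 : P [set 0].
  split=> [//|c x y -> ->|a n x ->]; first by rewrite /= scaler0 addr0.
  by rewrite /= linear0.
have S0 : S 0.
  have [S_eq0|/set0P[x Sx]] := eqVneq S set0.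
    by case: (Smax [set 0]) => //; rewrite S_eq0; split=> [//|/(_ 0)]; apply.
  by rewrite -(addNr x) -scaleN1r; apply: SL.
exists S; split=> // N [hN NY] SN.
have [Nw|Nw] := pselect (N w); first by right; apply: cyc.
left; apply: contrapT => NS; apply: (Smax N); last by split=> //; case: hN.
by split=> // NS'; apply: NS; apply/seteqP.
Qed.

End Subquotients.

(** A submodule of the generated one is also a submodule of [M], so the minimality
    of the latter applies. *)
Lemma generated_cyclic (K : numFieldType) (V : voa K) (M : weak_module V) (w : M)
    (N : set (sub_module (generated_submodule w))) :
  weak_submodule N -> N (to_sub (generated_submodule w).1 (@mem_generated _ _ _ w)) ->
  N = [set: sub_module (generated_submodule w)].
Proof.
move=> [[N0 NL] NY] Nw; pose N' := [set x : M | exists2 y, N y & x = val y].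
have hN' : weak_submodule N'.
  split; first split.
  - by exists 0; rewrite ?linear0.
  - move=> b _ _ [x Nx ->] [y Ny ->]; exists (b *: x + y); first exact: NL.
    by rewrite linearP.
  - by move=> a n _ [x Nx ->]; exists (wm_Y a n x); first exact: NY.
apply/seteqP; split=> // x _.
have [] := generated_min hN' _ (sub_spaceP x).
  by exists (to_sub (generated_submodule w).1 (@mem_generated _ _ _ w)).
by move=> y Ny /val_inj ->.
Qed.

(** * Weak modules graded by L(0)-eigenvalues *)

Section EigenGrading.
Variables (K : numFieldType) (V : voa K).

HB.instance Definition _ (M : weak_module V) (n : int) :=
  GRing.isLinear.Build K M M *:%R (@vir_L K V M n) ((wm_bilinear M).2 _ _).

Lemma L0_mode_eig (M : weak_module V) (k : int) (a : V) (n : int) (u : M) (e : K) :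
  voa_wt k a -> eig_space (vir_L 0) e u ->
  eig_space (vir_L 0) (e + (k - n - 1)%:~R) (wm_Y a n u).
Proof.
by move=> ka eu; rewrite /eig_space /= (L0_mode _ _ ka) eu linearZ /= scalerDl.
Qed.

Lemma sub_module_eig (M : weak_module V) (N : set M) (hN : weak_submodule N)
    (e : K) (x : sub_module hN) :
  eig_space (vir_L 0) e (val x) -> eig_space (@vir_L K V (sub_module hN) 0) e x.
Proof. by move=> ex; apply: val_inj; rewrite linearZ; exact: ex. Qed.

Lemma quot_module_eig (M : weak_module V) (N : set M) (hN : weak_submodule N)
    (e : K) (u : M) :
  eig_space (vir_L 0) e u ->
  eig_space (@vir_L K V (quot_module hN) 0) e (quot_proj N u).
Proof.
move=> eu; transitivity (quot_proj N (vir_L 0 u)).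
  exact: (quot_modesE hN).
by rewrite eu linearZ.
Qed.

Lemma natD_inj (c : K) : injective (fun i : nat => c + i%:R).
Proof. by move=> i j /addrI /eqP; rewrite eqr_nat => /eqP. Qed.

Section Spectrum.
Variables (M : weak_module V) (c : K).
Let G (i : nat) := eig_space (@vir_L K V M 0) (c + i%:R).

(** Eigencomponents stay in the submodule, because it is stable under [L(0)]. *)
Lemma sub_module_spectrum (N : set M) (hN : weak_submodule N) :
  N `<=` graded_sum G ->
  graded_sum (fun i => eig_space (@vir_L K V (sub_module hN) 0) (c + i%:R))
  = [set: sub_module hN].
Proof.
move=> NG; apply/seteqP; split=> // x _.
have [m [f [Gf xE]]] := NG _ (sub_spaceP x).
have Nf i : (i < m)%N -> N (f i).
  apply: (eigen_components (@natD_inj c) hN.1 _ Gf) => [y|]; first exact: hN.2.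
  by rewrite -xE; exact: sub_spaceP.
pose g i : sub_module hN :=
  if pselect (N (f i)) is left Nfi then to_sub hN.1 Nfi else 0.
exists m, g; split=> [i|].
  rewrite /g; case: pselect => [Nfi|_]; last exact: (subspace_eig _ _).1.
  by apply: sub_module_eig; exact: Gf.
apply: val_inj; rewrite xE linear_sum; apply: eq_bigr => i _; rewrite /g.
by case: pselect => // /(_ (Nf _ (ltn_ord i))).
Qed.

Lemma quot_module_spectrum (N : set M) (hN : weak_submodule N) :
  graded_sum G = [set: M] ->
  graded_sum (fun i => eig_space (@vir_L K V (quot_module hN) 0) (c + i%:R))
  = [set: quot_module hN].
Proof.
move=> tot; apply/seteqP; split=> // q _; have [x ->] := quot_proj_surj q.
have [m [f [Gf ->]]] : graded_sum G x by rewrite tot.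
exists m, (fun i => quot_proj N (f i)); split=> [i|]; last by rewrite linear_sum.
exact: quot_module_eig (Gf i).
Qed.

Lemma lowest_eigenvalue (n : nat) :
  graded_sum G = [set: M] -> G n != [set 0] ->
  exists m, [/\ (m <= n)%N, G m != [set 0] &
    graded_sum (fun i => eig_space (@vir_L K V M 0) (c + m%:R + i%:R)) = [set: M]].
Proof.
move=> tot Gn; have ex : exists m, G m != [set 0] by exists n.
case: (ex_minnP ex) => m Gm mmin; exists m; split=> //; first exact: mmin.
set G' := fun i : nat => _; have hG' i : subspace (G' i) by exact: subspace_eig.
apply/seteqP; split=> // x _.
have [p [f [Gf ->]]] : graded_sum G x by rewrite tot.
apply: subspace_sum => [|i _]; first exact: graded_sum_subspace.
have [Gi|Gi] := eqVneq (G i) [set 0].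
  by have := Gf i; rewrite Gi => ->; exact: (graded_sum_subspace hG').1.
apply: (@graded_sum_sub _ _ _ (i - m)) => [j|]; first exact: (hG' j).1.
by rewrite /G' -addrA -natrD subnKC; [exact: Gf|exact: mmin].
Qed.

End Spectrum.

Section L0Graded.
Variables (M : weak_module V) (c : K).
Hypothesis tot :
  graded_sum (fun i => eig_space (@vir_L K V M 0) (c + i%:R)) = [set: M].

Let G (i : nat) := eig_space (@vir_L K V M 0) (c + i%:R).

Lemma eig_grading : direct_sum G.
Proof. exact: (eigen_direct_sum (@natD_inj c)). Qed.

(** A shift to negative degree would give an eigenvector whose eigenvalue does
    not occur, so the result is 0. *)
Lemma eig_degree (k : int) (a : V) (n : int) (m : nat) (u : M) :
  voa_wt k a -> G m u -> extend_grading G (k + m%:Z - n - 1) (wm_Y a n u).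
Proof.
move=> ka Gu; have := L0_mode_eig n ka Gu.
rewrite -addrA -[m%:R]/(m%:Z%:~R) -intrD.
rewrite (_ : m%:Z + _ = k + m%:Z - n - 1); last by lia.
case: (k + m%:Z - n - 1) => [j|j] //= ej.
apply: (eigenvector_eq0 (@natD_inj c) _ ej); first by rewrite tot.
move=> i; rewrite -[i%:R]/(i%:Z%:~R) (inj_eq (addrI _)) eqr_int.
by apply/eqP; lia.
Qed.

Definition L0_graded_module : admissible_module V :=
  AdmissibleModule eig_grading eig_degree.

End L0Graded.

(** * The submodule where degree and L(0) agree up to a constant *)

Lemma homogeneous_ind (P : set V) : subspace P ->
  (forall k a, voa_wt k a -> P a) -> forall a, P a.
Proof.
move=> hP Pk a; have [f [[Gf _ ->] _]] := (voa_grading V).2 a.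
by apply: subspace_sum => // k _; exact: Pk (Gf k).
Qed.

Lemma submodule_homogeneous (M : weak_module V) (N : set M) : subspace N ->
  (forall k a n u, voa_wt k a -> N u -> N (wm_Y a n u)) -> weak_submodule N.
Proof.
move=> hN Nk; split=> // a n u Nu; move: a.
apply: (@homogeneous_ind [set a | N (wm_Y a n u)]) => [|k a ka /=].
  split=> [|c a b Na Nb] /=; rewrite -/(mode_at _ _ _).
    by rewrite linear0; case: hN.
  by rewrite linearP; apply: hN.2.
exact: Nk ka Nu.
Qed.

Lemma am_subspace (M : admissible_module V) i : subspace (@am_deg K V M i).
Proof. exact: (am_grading M).1. Qed.

(** The vectors on which [L(0)] acts as [c] plus the degree operator. *)
Definition coherent_part (M : admissible_module V) (c : K) : set M :=
  graded_sum (fun i => @am_deg K V M i `&` eig_space (vir_L 0) (c + i%:R)).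

(** A mode moves degree and eigenvalue by the same integer, and kills the vectors
    that it would send to a negative degree. *)
Lemma coherent_part_submodule (M : admissible_module V) (c : K) :
  weak_submodule (@coherent_part M c).
Proof.
have hG i : subspace (@am_deg K V M i `&` eig_space (vir_L 0) (c + i%:R)).
  by apply: subspaceI; [exact: am_subspace|exact: subspace_eig].
have hN : subspace (@coherent_part M c) by apply: graded_sum_subspace.
apply: submodule_homogeneous => // k a n u ka [m [f [Gf ->]]].
rewrite linear_sum; apply: subspace_sum => // i _.
have [Mfi Lfi] := Gf i.
have := am_degree n ka Mfi; have := L0_mode_eig n ka Lfi.
rewrite -addrA -[i%:R]/(i%:Z%:~R) -intrD.
rewrite (_ : i%:Z + _ = k + i%:Z - n - 1); last by lia.
case: (k + i%:Z - n - 1) => [j|j] /= Lj Mj; last by rewrite Mj; case: hN.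
by apply: (@graded_sum_sub _ _ _ j) => // l; case: (hG l).
Qed.

(** The conformal vector has weight 2, so [omega(1)] has degree 0. *)
Lemma L0_am_deg (M : admissible_module V) i (u : M) :
  am_deg i u -> @am_deg K V M i (vir_L 0 u).
Proof.
move=> Mu; have := am_degree 1 (conf_weight V) Mu.
by rewrite (_ : 2 + i%:Z - 1 - 1 = i%:Z) //; lia.
Qed.

(** The homogeneous components of [L(0) x - lam *: x = 0] vanish separately. *)
Lemma homogeneous_eigenvector (M : admissible_module V) (lam : K) :
  gen_eig_space (@vir_L K V M 0) lam <> [set 0] ->
  exists (i : nat) (w : M), [/\ w <> 0, am_deg i w & eig_space (vir_L 0) lam w].
Proof.
move=> gen; set T := fun w : M => vir_L 0 w - lam *: w.
have [v v0 [k kv]] : exists2 v : M, v != 0 & gen_eig_space (vir_L 0) lam v.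
  apply: contrapT => none; apply: gen; apply/seteqP; split=> [v gv|v ->].
    by apply/eqP/negPn/negP => v0; apply: none; exists v.
  by exists 0%N.
(* The last nonzero iterate of L(0) - lam at v is an eigenvector. *)
have [x x0 Lx] : exists2 x : M, x != 0 & T x = 0.
  elim: k v v0 kv => [|k IHk] v v0; first by move=> /= v_0; rewrite v_0 eqxx in v0.
  rewrite iterSr -/(T v) => kv; have [Tv|Tv] := eqVneq (T v) 0; first by exists v.
  exact: IHk kv.
have [m [f [Mf xE]]] : graded_sum (@am_deg K V M) x.
  by rewrite (direct_sum_graded_sum (am_grading M)).
have [i im fi] : exists2 i, (i < m)%N & f i <> 0.
  apply: contrapT => none; move/eqP: x0; apply; rewrite xE big1 // => i _.
  by apply: contrapT => fi; apply: none; exists i.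
exists i, (f i); split=> //; apply/eqP; rewrite -subr_eq0; apply/eqP.
apply: (direct_sum_eq0 (f := fun i => T (f i)) (am_grading M) _ _ im) => [j|].
  apply: subspaceB; [exact: am_subspace|exact: L0_am_deg|].
  by apply: subspaceZ; first exact: am_subspace.
by rewrite /T sumrB -linear_sum -scaler_sumr -xE.
Qed.

(** * The irreducible subquotient *)

(** The module sought is the simple quotient of the submodule generated by a
    homogeneous eigenvector. *)
Theorem lowest_weight_exists (M : admissible_module V) (lam : K) :
  gen_eig_space (@vir_L K V M 0) lam <> [set 0] ->
  exists2 mu, lowest_weights V mu & exists n : nat, lam = mu + n%:R.
Proof.
move=> /homogeneous_eigenvector[n0 [w [w0 Mw Lw]]].
pose c := lam - n0%:R; have cE : lam = c + n0%:R by rewrite subrK.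
have Cw : coherent_part c w.
  apply: (@graded_sum_sub _ _ _ n0) => [i|]; last by rewrite -cE.
  by split; [exact: (am_subspace M i).1|exact: (subspace_eig _ _).1].
pose hT := generated_submodule w; pose T := sub_module hT.
pose wT : T := to_sub hT.1 (@mem_generated _ _ _ w).
have [S [hS Sw Smax]] : exists S : set T, [/\ weak_submodule S, ~ S wT
    & forall N, weak_submodule N -> S `<=` N -> N = S \/ N = [set: T]].
  apply: maximal_submodule_avoiding => [/(congr1 val)//|N hN Nw].
  exact: generated_cyclic.
pose Q := quot_module hS; pose wQ : Q := quot_proj S wT.
have wQ0 : wQ <> 0 by move=> /(quot_proj_eq0 _ hS.1).
have Qtot : graded_sum (fun i : nat => eig_space (@vir_L K V Q 0) (c + i%:R))
    = [set: Q].
  apply: quot_module_spectrum; apply: sub_module_spectrum => x Tx.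
  have [p [f [Cf ->]]] := generated_min (coherent_part_submodule M c) Cw Tx.
  by exists p, f; split=> // i; case: (Cf i).
have Qn0 : eig_space (@vir_L K V Q 0) (c + n0%:R) != [set 0].
  apply/eqP => Q0; apply: wQ0.
  have : eig_space (@vir_L K V Q 0) (c + n0%:R) wQ.
    by apply: quot_module_eig; apply: sub_module_eig; rewrite -cE.
  by rewrite Q0.
have [m [mn0 Qm Qtot']] := lowest_eigenvalue Qtot Qn0.
exists (c + m%:R); last first.
  by exists (n0 - m)%N; rewrite -addrA -natrD subnKC.
exists (L0_graded_module Qtot'); split; last by split; [exact: eig_grading|].
split=> [|N [hN NY _]]; last by apply: quot_module_simple.
apply/eqP => Q0; apply: wQ0; have : [set: Q] wQ by [].
by rewrite [X in X wQ]Q0.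
Qed.

End EigenGrading.

Theorem proposition3p4 (R : realType) (V : voa R[i])
    (M : admissible_module V) (lam : R[i]) :
  semisimple (@zhu_mul R[i] V) ->
  ~ [set mu + n%:R | mu in lowest_weights V & n in [set: nat]] lam ->
  gen_eig_space (@vir_L R[i] V M 0) lam = [set 0].
Proof.
move=> _ lamP; apply: contrapT => /lowest_weight_exists[mu Pmu [n lamE]].
by apply: lamP; exists mu => //; exists n.
Qed.
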